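(* Let $S$ be a finite set, $d\ge 1$, and let $X\subset S^{\mathbb Z^d}$ be an irreducible $\mathbb Z^d$-topological Markov shift such that the tail relation $\mathfrak T(X)$ is topologically transitive on $X$. Let $\mathbb G$ be a countable Abelian group and $G:S\to\mathbb G$. If $p$ is a Borel probability measure on $X$ which is global, $\mathfrak T(X)$-nonsingular, and $\mathfrak T(X)[\Psi_G]$-invariant and $\mathfrak T(X)[\Psi_G]$-ergodic, then there is a group homomorphism $H:\mathbb G\to\mathbb R$ such that $p$ is $H\circ G$-conformal, i.e. for every Borel bijection $\Phi:B\to C$ between Borel sets $B,C\subset X$ with $(x,\Phi(x))\in\mathfrak T(X)$ for all $x\in B$, one has $\frac{d\,p\circ\Phi}{dp}(x)=e^{H(\Psi_G(x,\Phi(x)))}$ for $p$-a.e. $x\in B$.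
   Context: Notation: for $n\in\mathbb Z^d$, $\|n\|=\max_k|n_k|$ and $B(n,r)=\{k\in\mathbb Z^d:\|k-n\|\le r\}$. For $x\in S^{\mathbb Z^d}$ and $\Lambda\subset\mathbb Z^d$, $x_\Lambda\in S^\Lambda$ is the restriction. The shift is $(T_kx)_n=x_{n+k}$. A $\mathbb Z^d$-topological Markov shift (TMS) is a set of the form $X=\{x\in S^{\mathbb Z^d}:(x_k,(x_{k+j})_{j\in\partial B(0,1)})\in A\ \forall k\in\mathbb Z^d\}$ for some $A\subset S\times S^{\partial B(0,1)}$, where $\partial B(0,1)=B(0,1)\setminus\{0\}$. $X$ is irreducible if for all nonempty open $U,V\subset X$ there is $k\in\mathbb Z^d$ with $U\cap T_kV\ne\emptyset$. The tail relation is $\mathfrak T(X)=\{(x,y)\in X\times X:\exists F\subset\mathbb Z^d\text{ finite},\ x_{F^c}=y_{F^c}\}$. For $G:S\to\mathbb G$ and $(x,y)\in\mathfrak T(X)$, $\Psi_G(x,y)=\sum_{j\in\mathbb Z^d}(G(y_j)-G(x_j))$ (a finite sum), and $\mathfrak T(X)[\Psi_G]=\{(x,y)\in\mathfrak T(X):\Psi_G(x,y)=0\}$. For a countable Borel equivalence relation $\mathcal R$ on $X$: $\mathcal R$ is topologically transitive if $(U\times V)\cap\mathcal R\neq\emptyset$ for all nonempty open $U,V\subset X$; $p$ is $\mathcal R$-nonsingular if $p(A)=0$ implies $p(\mathcal R(A))=0$, where $\mathcal R(A)=\{y:\exists x\in A,(x,y)\in\mathcal R\}$; $p$ is $\mathcal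 R$-invariant if it is nonsingular and every Borel bijection $\Phi:B\to C$ with $(x,\Phi(x))\in\mathcal R$ preserves $p$ (i.e. $p\circ\Phi=p$ on $B$); $p$ is $\mathcal R$-ergodic if every Borel set $A$ with ($x\in A$, $(x,y)\in\mathcal R$ $\Rightarrow y\in A$) has $p(A)\in\{0,1\}$. $p$ is global if every nonempty open subset of $X$ has positive $p$-measure. *)

(* Defs.v *)
From HB Require Import structures.
From mathcomp Require Import all_boot all_order all_algebra.
From mathcomp Require Import all_classical all_reals all_analysis.
Set Implicit Arguments. Unset Strict Implicit. Unset Printing Implicit Defensive.
Import Order.TTheory GRing.Theory Num.Theory.
Local Open Scope classical_set_scope.
Local Open Scope ring_scope.

Definition Zd (d : nat) := 'rV[int]_d.

Definition supnorm d (n : Zd d) : nat := \max_(k < d) `|n ord0 k|%N.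

(** The alphabet S, with a distinguished point s0; the point is only used to
    equip the configuration space with the pointedType structure that
    MathComp-Analysis requires for measurable types. *)
Definition alph (S : finType) (s0 : S) : Type := S.
HB.instance Definition _ (S : finType) (s0 : S) := Choice.on (alph s0).
HB.instance Definition _ (S : finType) (s0 : S) := isPointed.Build (alph s0) s0.

Definition cfg d (S : finType) (s0 : S) := Zd d -> alph s0.

(** Open sets of the product topology on S^{Z^d} (S discrete): U is open iff
    every x in U has a cylinder neighbourhood {y : y_{B(0,r)} = x_{B(0,r)}}
    contained in U (the boxes B(0,r) are cofinal among finite windows). *)
Definition cfg_open d (S : finType) (s0 : S) : set (set (cfg d s0)) :=
  [set U | forall x, U x -> exists r : nat,
     forall y : cfg d s0, (forall j, (supnorm j <= r)%N -> y j = x j) -> U y].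

Definition cfgB d (S : finType) (s0 : S) := g_sigma_algebraType (@cfg_open d S s0).

Section Defs.
Context (d : nat) (S : finType) (s0 : S).
Local Notation Omega := (cfgB d s0).

Definition tms_open_in (X U : set Omega) : Prop :=
  exists V, cfg_open V /\ U = X `&` V.

Definition tms_shift (k : Zd d) (x : Omega) : Omega := fun n => x (n + k).

Definition tms_nbr := {j : Zd d | (supnorm j <= 1)%N && (j != 0)}.

Definition tms_is_TMS (X : set Omega) : Prop :=
  exists A : set (S * (tms_nbr -> S)),
    X = [set x | forall k : Zd d, A (x k, fun j : tms_nbr => x (k + sval j))].

Definition tms_irreducible (X : set Omega) : Prop :=
  forall U V, tms_open_in X U -> tms_open_in X V -> U !=set0 -> V !=set0 ->
    exists k : Zd d, (U `&` (tms_shift k @` V)) !=set0.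

Definition tms_tail (X : set Omega) (x y : Omega) : Prop :=
  X x /\ X y /\ exists F : set (Zd d), finite_set F /\ forall n, ~ F n -> x n = y n.

Definition tms_Psi (GG : zmodType) (G : S -> GG) (x y : Omega) : GG :=
  \sum_(j \in [set: Zd d]) (G (y j) - G (x j)).

Definition tms_tail_Psi (X : set Omega) (GG : zmodType) (G : S -> GG) (x y : Omega) : Prop :=
  tms_tail X x y /\ tms_Psi G x y = 0.

Definition tms_top_transitive (X : set Omega) (Rel : Omega -> Omega -> Prop) : Prop :=
  forall U V, tms_open_in X U -> tms_open_in X V -> U !=set0 -> V !=set0 ->
    exists x y, U x /\ V y /\ Rel x y.

Definition tms_saturation (Rel : Omega -> Omega -> Prop) (A : set Omega) : set Omega :=
  [set y | exists x, A x /\ Rel x y].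

(** Phi : B -> C is a Borel bijection between Borel sets B, C
    (Borel measurable, bijective, with Borel measurable inverse, i.e. Phi maps
    Borel subsets of B to Borel sets). *)
Definition tms_borel_bij (B C : set Omega) (Phi : Omega -> Omega) : Prop :=
  measurable B /\ measurable C /\
  (forall x, B x -> C (Phi x)) /\
  (forall x y, B x -> B y -> Phi x = Phi y -> x = y) /\
  (forall z, C z -> exists x, B x /\ Phi x = z) /\
  measurable_fun B Phi /\
  (forall A, measurable A -> A `<=` B -> measurable (Phi @` A)).

Context (R : realType).

Definition tms_global (p : probability Omega R) (X : set Omega) : Prop :=
  forall U, tms_open_in X U -> U !=set0 -> (0 < p U)%E.

Definition tms_nonsingular (p : probability Omega R) (X : set Omega)
  (Rel : Omega -> Omega -> Prop) : Prop :=
  forall A, measurable A -> A `<=` X -> p A = 0%E -> p (tms_saturation Rel A) = 0%E.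

Definition tms_invariant (p : probability Omega R) (X : set Omega)
  (Rel : Omega -> Omega -> Prop) : Prop :=
  tms_nonsingular p X Rel /\
  forall B C Phi, tms_borel_bij B C Phi -> B `<=` X -> C `<=` X ->
    (forall x, B x -> Rel x (Phi x)) ->
    forall A, measurable A -> A `<=` B -> p (Phi @` A) = p A.

Definition tms_ergodic (p : probability Omega R) (X : set Omega)
  (Rel : Omega -> Omega -> Prop) : Prop :=
  forall A, measurable A -> A `<=` X ->
    (forall x y, A x -> Rel x y -> A y) -> p A = 0%E \/ p A = 1%E.

(** p is f-tms_conformal: for every Borel bijection Phi : B -> C inside T(X),
    d(p o Phi)/dp (x) = exp (f(tms_Psi... )) i.e. (p o Phi)(A) = int_A e^{..} dp
    for every Borel A subset of B (definition of the Radon-Nikodym derivative). *)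
Definition tms_conformal (p : probability Omega R) (X : set Omega)
  (c : Omega -> Omega -> R) : Prop :=
  forall B C Phi, tms_borel_bij B C Phi -> B `<=` X -> C `<=` X ->
    (forall x, B x -> tms_tail X x (Phi x)) ->
    forall A, measurable A -> A `<=` B ->
      p (Phi @` A) = (\int[p]_(x in A) (expR (c x (Phi x)))%:E)%E.

End Defs.

(* Main.v *)
Require Import Defs.
From HB Require Import structures.
From mathcomp Require Import all_boot all_order all_algebra.
From mathcomp Require Import all_classical all_reals all_analysis.
From mathcomp Require Import measurable_realfun.
Import Order.TTheory GRing.Theory Num.Theory.
Local Open Scope classical_set_scope.
Local Open Scope ring_scope.
Set Implicit Arguments. Unset Strict Implicit. Unset Printing Implicit Defensive.

(* Two tail-equivalent configurations differ by overwriting finitely many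
   sites, so the tail relation is the union of countably many partial
   bijections ("patches"), each with a constant value g of Psi.  If the domain
   of such a patch t had two parts of positive measure on which the density of
   p o t with respect to p differed, ergodicity of the kernel of Psi would move
   a piece of one part onto a piece of the other inside the kernel; the images
   of the two pieces under t are again related inside the kernel, so invariance
   gives them equal measure, a contradiction.  The same argument with two
   patches sharing the value g shows that the density is a constant c(g)
   depending on g alone.  The values g carried by some patch of positive measure
   form a subgroup on which ln c is additive, and it extends to the whole group
   because R is divisible.  Patches with other values live on null sets. *)

(** * Extension of partial homomorphisms into a divisible group *)

(** A homomorphism on a subgroup is encoded by its graph, so that extensions are ordered by
    inclusion: closure under differences makes a nonempty [f] a subgroup, and triviality over 0
    makes it single-valued. *)
Definition partial_hom (V W : zmodType) (f : set (V * W)) :=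
  (forall a b v w, f (a, v) -> f (b, w) -> f (a - b, v - w)) /\
  (forall w, f (0, w) -> w = 0).

Lemma partial_hom_zmod (V W : zmodType) (f : set (V * W)) :
  partial_hom f -> f !=set0 ->
  [/\ f (0, 0), forall a v, f (a, v) -> f (- a, - v),
      forall a b v w, f (a, v) -> f (b, w) -> f (a + b, v + w)
    & forall a v (m : int), f (a, v) -> f (a *~ m, v *~ m)].
Proof.
move=> [fB _] [[c w] fc].
have f0 : f (0, 0) by rewrite -{1}(subrr c) -(subrr w); exact: fB.
have fN a v : f (a, v) -> f (- a, - v).
  by move=> fa; rewrite -(sub0r a) -(sub0r v); exact: fB.
have fD a b u v : f (a, u) -> f (b, v) -> f (a + b, u + v).
  by move=> fa fb; rewrite -[b]opprK -[v]opprK; apply: fB => //; exact: fN.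
split=> // a v m fa.
have fM n : f (a *+ n, v *+ n).
  by elim: n => [|n ih]; rewrite ?mulr0n// !mulrS; exact: fD.
by case: m => n; [exact: fM|exact: fN].
Qed.

Lemma partial_hom_fun (V W : zmodType) (f : set (V * W)) a v w :
  partial_hom f -> f (a, v) -> f (a, w) -> v = w.
Proof.
move=> [fB f0] fv fw; apply/eqP; rewrite -subr_eq0; apply/eqP/f0.
by have := fB _ _ _ _ fv fw; rewrite subrr.
Qed.

(** If a nonzero multiple [a *~ m] has a value [w], divisibility offers [w / m]; comparing values at
    [a *~ (m * m')] shows that it fits every other multiple. *)
Lemma partial_hom_value (V : zmodType) (R : numFieldType) (f : set (V * R))
    (a : V) : partial_hom f -> f !=set0 ->
  exists v : R, forall (m : int) w, f (a *~ m, w) -> w = v *~ m.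
Proof.
move=> fP fn; have [f0 fN fD fM] := partial_hom_zmod fP fn.
have [[m [w [m0 fmw]]]|nex] :=
    pselect (exists m w, m != 0 :> int /\ f (a *~ m, w)).
  exists (w / m%:~R) => m' w' fmw'.
  have e1 := fM _ _ m' fmw; have e2 := fM _ _ m fmw'.
  rewrite -mulrzA in e1; rewrite -mulrzA mulrC in e2.
  have e := partial_hom_fun fP e1 e2.
  have mR : m%:~R != 0 :> R by rewrite intr_eq0.
  apply: (mulIf mR).
  by rewrite -[_ *~ m']mulrzr mulrAC divfK// !mulrzr.
(* Only the zero multiple can lie in the domain, so any value would do. *)
exists 0 => m w fmw; have [m0|m0] := eqVneq m 0; last by case: nex; exists m, w.
by rewrite m0 !mulr0z in fmw *; case: fP => _; apply.
Qed.

(* Injectivity of the divisible group R: a maximal graph is total. *)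
Lemma partial_hom_extend (V : zmodType) (R : numFieldType) (f : set (V * R)) :
  partial_hom f -> f (0, 0) ->
  exists H : V -> R, (forall a b, H (a + b) = H a + H b) /\
    forall a w, f (a, w) -> H a = w.
Proof.
move=> fP f00.
pose P (h : set (V * R)) := h = set0 \/ (f `<=` h /\ partial_hom h).
have [F FP Ftot|h [hP hmax]] := @Zorn_bigcup _ P.
  have [Fne|] := pselect (exists h, F h /\ h !=set0); last first.
    move=> nF; left; apply/seteqP; split=> // x [h Fh hx].
    by apply: nF; exists h; split=> //; exists x.
  right; case: Fne => h0 [Fh0 h0n].
  have FP' h x : F h -> h x -> f `<=` h /\ partial_hom h.
    by move=> Fh hx; case: (FP _ Fh) => // h_0; rewrite h_0 in hx.
  split.
    by case: h0n => x h0x y fy; exists h0 => //; apply: (FP' h0 x Fh0 h0x).1.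
  split=> [a b v w [h Fh ha] [k Fk kb]|w [h Fh hw]].
    have [hk|kh] := Ftot _ _ Fh Fk.
      by exists k => //; apply: (FP' k _ Fk kb).2.1 => //; exact: hk.
    by exists h => //; apply: (FP' h _ Fh ha).2.1 => //; exact: kh.
  exact: (FP' h (0, w) Fh hw).2.2.
have {hP} [fh hP] : f `<=` h /\ partial_hom h.
  case: hP => // h0; exfalso; apply: (hmax f); last by right; split.
  by rewrite h0; split=> // /(_ _ f00).
have hn : h !=set0 by exists (0, 0); exact: fh.
have [h0 hN hD hM] := partial_hom_zmod hP hn.
have htot a : exists w, h (a, w).
  apply: contrapT => na; have [v vP] := partial_hom_value a hP hn.
  (* The graph generated by [h] and the new pair [(a, v)]. *)
  pose k := [set z | exists (m : int) b u,
    h (b, u) /\ z = (b + a *~ m, u + v *~ m)].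
  have hk : h `<=` k.
    by move=> [b u] hz; exists 0, b, u; rewrite !mulr0z !addr0.
  apply: (hmax k).
    split=> // kh; apply: na; exists v; apply: kh; exists 1, 0, 0; split=> //.
    by rewrite !mulr1z !add0r.
  right; split; first exact: subset_trans hk.
  split=> [_ _ _ _ [m [b [u [hb [-> ->]]]]] [m' [b' [u' [hb' [-> ->]]]]]|].
    exists (m - m'), (b - b'), (u - u'); split; first exact: hP.1.
    by rewrite !mulrzBr !opprD; congr (_, _); rewrite addrACA.
  move=> w [m [b [u [hb [e ->]]]]].
  (* Over 0 the element [b] is a multiple of [a], where the choice of [v] prescribes the value of
     [h]. *)
  have : h (a *~ (- m), u).
    by rewrite mulrNz; move/esym/eqP : e; rewrite addr_eq0 => /eqP <-.
  by move/vP => ->; rewrite mulrNz addNr.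
have [H HP] := choice htot.
exists H; split=> [a b|a w faw].
  exact: (partial_hom_fun hP (HP _) (hD _ _ _ _ (HP a) (HP b))).
by apply: (partial_hom_fun hP (HP _)); exact: fh.
Qed.

(** * Subsets on which a Radon-Nikodym density is bounded on one side *)

Section density.
Context (d : measure_display) (T : measurableType d) (R : realType).
Variables (mu nu : {finite_measure set T -> \bar R}).
Hypothesis numu : nu `<< mu.
Local Open Scope ereal_scope.

(** [B] is the part of [A] where the density is below [q]. Were it null, the density would be at
    least [q] almost everywhere on [A], forcing [q%:E * mu A <= nu A]. *)
Lemma exists_light_subset (A : set T) (q : R) : measurable A -> (0 <= q)%R ->
  nu A < q%:E * mu A ->
  exists B, [/\ measurable B, B `<=` A, 0 < mu B &
    forall C, measurable C -> C `<=` B -> nu C <= q%:E * mu C].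
Proof.
move=> mA q0 nuA; have [f [f0 /measurable_int mf fE]] := radon_nikodym_finite numu.
have mfD D : measurable_fun D f by apply: (measurable_funS measurableT).
have mB : measurable (A `&` [set x | f x < q%:E]).
  by apply: emeasurable_fun_infty_o => //; exact: mfD.
exists (A `&` [set x | f x < q%:E]); split=> //.
  rewrite lt0e measure_ge0 andbT; apply/eqP => B0.
  have mAB : measurable (A `\` (A `&` [set x | f x < q%:E])) by exact: measurableD.
  move: nuA; apply/negP; rewrite -leNgt.
  have -> : mu A = mu (A `\` (A `&` [set x | f x < q%:E])).
    rewrite -[in LHS](@setDUK _ (A `&` [set x | f x < q%:E]) A)//.
    by rewrite setUC measureU0.
  rewrite fE// -integral_cst//.
  apply: (@le_trans _ _ (\int[mu]_(x in A `\` (A `&` [set x | f x < q%:E])) f x)).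
    apply: ge0_le_integral => //; do ?[exact: mfD|by move=> x _; rewrite lee_fin].
    by move=> x [Ax /not_andP[//|/negP]]; rewrite -leNgt.
  by apply: ge0_subset_integral => //; exact: mfD.
move=> C mC CB; rewrite fE// -integral_cst//.
apply: ge0_le_integral => //; do ?[exact: mfD|by move=> x _; rewrite lee_fin].
by move=> x /CB[_ /ltW].
Qed.

(** The same argument with the part of [A] where the density exceeds [q]; if this part were
    [mu]-null, it would be [nu]-null as well. *)
Lemma exists_heavy_subset (A : set T) (q : R) : measurable A -> (0 <= q)%R ->
  q%:E * mu A < nu A ->
  exists B, [/\ measurable B, B `<=` A, 0 < mu B &
    forall C, measurable C -> C `<=` B -> q%:E * mu C <= nu C].
Proof.
move=> mA q0 nuA; have [f [f0 /measurable_int mf fE]] := radon_nikodym_finite numu.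
have mfD D : measurable_fun D f by apply: (measurable_funS measurableT).
have mB : measurable (A `&` [set x | q%:E < f x]).
  by apply: emeasurable_fun_o_infty => //; exact: mfD.
exists (A `&` [set x | q%:E < f x]); split=> //.
  rewrite lt0e measure_ge0 andbT; apply/eqP => B0.
  have mAB : measurable (A `\` (A `&` [set x | q%:E < f x])) by exact: measurableD.
  move: nuA; apply/negP; rewrite -leNgt.
  have nB0 : nu (A `&` [set x | q%:E < f x]) = 0.
    by rewrite fE// null_set_integral//; exact: mfD.
  have -> : nu A = nu (A `\` (A `&` [set x | q%:E < f x])).
    rewrite -[in LHS](@setDUK _ (A `&` [set x | q%:E < f x]) A)//.
    by rewrite setUC measureU0.
  apply: (@le_trans _ _ (q%:E * mu (A `\` (A `&` [set x | q%:E < f x])))).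
    rewrite fE// -integral_cst//.
    apply: ge0_le_integral => //; do ?[exact: mfD|by move=> x _; rewrite lee_fin].
    by move=> x [Ax /not_andP[//|/negP]]; rewrite -leNgt.
  by apply: lee_wpmul2l => //; apply: le_measure; rewrite ?inE.
move=> C mC CB; rewrite fE// -integral_cst//.
apply: ge0_le_integral => //; do ?[exact: mfD|by move=> x _; rewrite lee_fin].
by move=> x /CB[_ /ltW].
Qed.

End density.

(** * Finite changes of configurations and their measurability *)

Section overwriting.
Context (d : nat) (S : finType) (s0 : S).
Local Notation Omega := (cfgB d s0).
Implicit Types (x y z : Omega) (t u v : seq S).

(** Numbering the sites lets a list describe a finite change, so there are only countably many
    changes, and lets initial segments of the numbering serve as finite windows. *)
Definition site (n : Zd d) : nat := pickle (n : 'rV[int]_d).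

Lemma site_inj : injective site.
Proof. exact: (pcan_inj pickleK). Qed.

(** The default [x n] of [nth] leaves the sites numbered beyond the list untouched. *)
Definition overwrite t x : Omega := fun n => nth (x n) t (site n).

Definition tail_eq x y := exists F : set (Zd d), finite_set F /\
  forall n, ~ F n -> x n = y n.

Lemma finite_site_lt N : finite_set [set n : Zd d | (site n < N)%N].
Proof.
apply: (@finite_preimage _ _ `I_N site); last exact: finite_II.
by move=> n m _ _; exact: site_inj.
Qed.

Lemma supnorm_site_bounded N : exists r, forall n : Zd d, (site n < N)%N ->
  (supnorm n <= r)%N.
Proof.
have /finite_seqP[A AE] := finite_site_lt N.
exists (\max_(n <- A) supnorm n)%N => n nN.
apply: (@leq_bigmax_seq 'rV[int]_d A xpredT (@supnorm d) n) => //.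
by rewrite -[is_true _]/([set` A] n) -AE.
Qed.

Lemma tail_eq_site x y : tail_eq x y <->
  exists N, forall n, (N <= site n)%N -> x n = y n.
Proof.
split=> [[F [/finite_seqP[A ->] xy]]|[N xy]]; last first.
  exists [set n | (site n < N)%N]; split; first exact: finite_site_lt.
  by move=> n /negP; rewrite -leqNgt; exact: xy.
exists (\max_(n <- A) site n).+1%N => n nN; apply: xy => /= nA.
by move: nN; rewrite ltnNge (@leq_bigmax_seq 'rV[int]_d A xpredT site n).
Qed.

Lemma tail_eq_refl x : tail_eq x x.
Proof. by exists set0. Qed.

Lemma tail_eq_sym x y : tail_eq x y -> tail_eq y x.
Proof. by move=> [F [Ff xy]]; exists F; split=> // n /xy. Qed.

Lemma tail_eq_trans x y z : tail_eq x y -> tail_eq y z -> tail_eq x z.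
Proof.
move=> /tail_eq_site[N xy] /tail_eq_site[M yz]; apply/tail_eq_site.
exists (maxn N M) => n; rewrite geq_max => /andP[Nn Mn].
by rewrite xy// yz.
Qed.

Lemma tail_eq_overwrite t x : tail_eq x (overwrite t x).
Proof.
by apply/tail_eq_site; exists (size t) => n tn; rewrite /overwrite nth_default.
Qed.

Lemma overwrite_tail_eq x y : tail_eq x y -> exists t, overwrite t x = y.
Proof.
move=> /tail_eq_site[N xy].
(* The default [s0] fills indices that number no site, so it is never read. *)
exists (mkseq (fun k => if unpickle k is Some n then y n else s0) N).
apply/funext => n; rewrite /overwrite.
have [nN|nN] := ltnP (site n) N; first by rewrite nth_mkseq// /site pickleK.
by rewrite nth_default ?size_mkseq// xy.
Qed.

Lemma cfg_open_site (U : set (cfg d s0)) :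
  (forall x, U x -> exists N, forall y : cfg d s0,
     (forall n, (site n < N)%N -> y n = x n) -> U y) -> cfg_open U.
Proof.
move=> UP x /UP[N NP]; have [r rP] := supnorm_site_bounded N.
by exists r => y yx; apply: NP => n /rP; exact: yx.
Qed.

Lemma cfg_open_measurable (U : set Omega) : cfg_open U -> measurable U.
Proof. by move=> oU; exact: sub_sigma_algebra. Qed.

Lemma measurable_overwrite t : measurable_fun [set: Omega] (overwrite t).
Proof.
apply: (@measurability _ _ Omega Omega setT (overwrite t) _ erefl).
move=> _ [U oU <-].
rewrite setTI; apply: cfg_open_measurable => x /= /oU[r rP].
by exists r => y yx; apply: rP => n nr; rewrite /overwrite yx.
Qed.

Lemma measurable_coordinate (n : Zd d) (s : S) :
  measurable ([set x | x n = s] : set Omega).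
Proof.
apply: cfg_open_measurable => x /= xn; exists (supnorm n) => y yx /=.
by rewrite yx.
Qed.

(** Beyond the longer list both changes act trivially, so membership depends on a finite window and
    the set is open. *)
Lemma measurable_overwriteK t u :
  measurable ([set x | overwrite u (overwrite t x) = x] : set Omega).
Proof.
apply: cfg_open_measurable; apply: cfg_open_site => x /= xK.
exists (maxn (size t) (size u)) => y yx; apply/funext => n.
have [nN|] := ltnP (site n) (maxn (size t) (size u)).
  by have := congr1 (@^~ n) xK; rewrite /overwrite yx.
by rewrite geq_max /overwrite => /andP[? ?]; rewrite !nth_default.
Qed.

(** The complement is open: a violation of the rule at [k] is visible in a box containing [k] and
    its neighbours. *)
Lemma measurable_TMS (X : set Omega) : tms_is_TMS X -> measurable X.
Proof.
move=> [A ->]; rewrite -[X in measurable X]setCK; apply: measurableC.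
apply: cfg_open_measurable => x /= /existsNP[k Ak].
have [r rP] : exists r, forall j : Zd d, (supnorm j <= 1)%N -> (supnorm (k + j)%R <= r)%N.
  exists (supnorm k + 1)%N => j j1; apply/bigmax_leqP => i _.
  rewrite mxE (@leq_trans (`|k ord0 i| + `|j ord0 i|)%N)//.
    by rewrite -lez_nat PoszD !abszE ler_normD.
  rewrite leq_add//.
    exact: (@leq_bigmax _ (fun i => `|k ord0 i|%N)).
  by rewrite (leq_trans _ j1)//; exact: (@leq_bigmax _ (fun i => `|j ord0 i|%N)).
exists r => y yx yA; apply: Ak; move: (yA k).
rewrite yx; last first.
  rewrite -[k]addr0; apply: rP; apply/bigmax_leqP => i _; rewrite mxE//.
congr (A (_, _)); apply/funext => -[j /= /andP[j1 _]].
by rewrite yx//; exact: rP.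
Qed.

(** A disagreement is witnessed by a site and a symbol, and there are countably many such pairs. *)
Lemma measurable_eq_fun (A : set Omega) (f g : Omega -> Omega) : measurable A ->
  measurable_fun A f -> measurable_fun A g ->
  measurable (A `&` [set x | f x = g x]).
Proof.
move=> mA mf mg.
have -> : A `&` [set x | f x = g x] = A `&` ~` \bigcup_(k : 'rV[int]_d * S)
    (A `&` f @^-1` [set x | x k.1 = k.2] `&` (A `&` ~` (g @^-1` [set x | x k.1 = k.2]))).
  apply/seteqP; split=> x [Ax fg]; split=> //.
    by move=> [[n s] _ [[_ /= fn] [_ /= gn]]]; apply: gn; rewrite -fg.
  apply/funext => n; apply: contrapT => nfg; apply: fg.
  by exists (n, f x n) => //; split=> //; split=> //= e; apply: nfg.
apply: measurableI => //; apply: measurableC.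
apply: countable_bigcupT_measurable => //= -[n s] /=.
have mns := measurable_coordinate n s.
apply: measurableI; first exact: mf.
by rewrite preimage_setC; apply: mg => //; exact: measurableC.
Qed.

(** * The cocycle [Psi] on tail-equivalent configurations *)

Section Psi.
Context (GG : zmodType) (G : S -> GG).
Local Notation Psi := (@tms_Psi d S s0 GG G).

(** A finite window common to several pairs makes their sums termwise comparable; the cocycle
    identity rests on this. *)
Lemma PsiE x y N : (forall n, (N <= site n)%N -> x n = y n) ->
  Psi x y = \sum_(n \in [set n : Zd d | (site n < N)%N]) (G (y n) - G (x n)).
Proof.
move=> xy; rewrite /tms_Psi; symmetry; apply: fsbig_widen => //.
by move=> n [_ /= /negP]; rewrite -leqNgt => /xy ->; rewrite /= subrr.
Qed.

Lemma Psi_trans x y z : tail_eq x y -> tail_eq y z ->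
  Psi x z = Psi x y + Psi y z.
Proof.
move=> /tail_eq_site[N xy] /tail_eq_site[M yz].
pose K := maxn N M.
have xyK n : (K <= site n)%N -> x n = y n.
  by rewrite geq_max => /andP[/xy].
have yzK n : (K <= site n)%N -> y n = z n.
  by rewrite geq_max => /andP[_ /yz].
have xzK n : (K <= site n)%N -> x n = z n by move=> h; rewrite xyK// yzK.
rewrite (PsiE xyK) (PsiE yzK) (PsiE xzK) -fsbig_split; last exact: finite_site_lt.
by apply: eq_fsbigr => n _ /=; rewrite [RHS]addrC addrA subrK.
Qed.

Lemma Psi_refl x : Psi x x = 0.
Proof. by rewrite /tms_Psi fsbig1// => n _; rewrite subrr. Qed.

Lemma Psi_sym x y : tail_eq x y -> Psi y x = - Psi x y.
Proof.
move=> xy; apply/eqP; rewrite -addr_eq0 -Psi_trans// ?Psi_refl//.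
exact: tail_eq_sym.
Qed.

(** The value depends only on the entries of [x] that [t] replaces, so the set is open. *)
Lemma measurable_Psi_overwrite t (g : GG) :
  measurable ([set x | Psi x (overwrite t x) = g] : set Omega).
Proof.
apply: cfg_open_measurable; apply: cfg_open_site => x /= <-.
exists (size t) => y yx; apply: eq_fsbigr => n _.
have [/yx nt|nt] := ltnP (site n) (size t); first by rewrite /overwrite nt.
by rewrite /overwrite !nth_default// !subrr.
Qed.

End Psi.
End overwriting.

(** * Countable covers and positive measure *)

Lemma bigcup_unpickle (I : countType) T (F : I -> set T) :
  \bigcup_i F i = \bigcup_n (if @unpickle I n is Some i then F i else set0).
Proof.
apply/seteqP; split=> x.
  by move=> [i _ Fx]; exists (pickle i) => //; rewrite pickleK.
by move=> [n _]; case: unpickle => // i Fx; exists i.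
Qed.

(** Otherwise countable subadditivity would make [A] null. *)
Lemma exists_measure_gt0 (d : measure_display) (T : measurableType d)
    (R : realType) (mu : {measure set T -> \bar R}) (I : countType)
    (A : set T) (F : I -> set T) : measurable A -> (forall i, measurable (F i)) ->
  A `<=` \bigcup_i F i -> (0 < mu A)%E -> exists i, (0 < mu (A `&` F i))%E.
Proof.
move=> mA mF AF; apply: contraPP => /forallNP nF.
have F0 i : mu (A `&` F i) = 0%E.
  apply/eqP; rewrite -measure_le0 leNgt; apply/negP; exact: nF.
apply/negP; rewrite -leNgt.
pose F' n := if @unpickle I n is Some i then A `&` F i else set0.
have mF' n : measurable (F' n).
  by rewrite /F'; case: unpickle => // i; exact: measurableI.
have AF' : A `<=` \bigcup_n F' n.
  rewrite -(@bigcup_unpickle I T (fun i => A `&` F i)) -setI_bigcupr => x Ax.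
  by split=> //; exact: AF.
have /le_trans : (mu A <= \sum_(n <oo) mu (F' n))%E.
  exact: measure_sigma_subadditive.
apply; rewrite eseries0// => n _ _.
by rewrite /F'; case: unpickle => [i|]; rewrite ?F0 ?measure0.
Qed.

(** * Patches: countably many partial bijections making up the tail relation *)

Section patches.
Context (d : nat) (S : finType) (s0 : S).
Local Notation Omega := (cfgB d s0).
Implicit Types (x y z : Omega) (t u v w : seq S).

Lemma borel_bij_comp (A B C : set Omega) (f g : Omega -> Omega) :
  tms_borel_bij A B f -> tms_borel_bij B C g -> tms_borel_bij A C (g \o f).
Proof.
move=> [mA [mB [fAB [fi [fs [mf fm]]]]]] [_ [mC [gBC [gi [gs [mg gm]]]]]].
do 2![split=> //]; split; [|split; [|split; [|split]]].
- by move=> x /fAB/gBC.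
- by move=> x y Ax Ay e; apply: fi => //; apply: gi e; exact: fAB.
- by move=> z /gs[y [/fs[x [Ax <-]] <-]]; exists x.
- by apply: (measurable_comp mB) => // _ [x Ax <-]; exact: fAB.
- move=> D mD DA; rewrite -image_comp; apply: gm; first exact: fm.
  by move=> _ [x Dx <-]; apply/fAB/DA.
Qed.

Context (X : set Omega) (mX : measurable X) (GG : zmodType) (G : S -> GG).
Local Notation Psi := (@tms_Psi d S s0 GG G).

(* [overwrite t] is a bijection from [patch_dom t u g] onto
   [patch_dom u t (- g)], with inverse [overwrite u]. *)
Definition patch_dom t u (g : GG) : set Omega :=
  [set x | [/\ X x, X (overwrite t x), overwrite u (overwrite t x) = x &
    Psi x (overwrite t x) = g]].

Lemma tms_tailE x y : tms_tail X x y <-> [/\ X x, X y & tail_eq x y].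
Proof. by split=> [[Xx [Xy xy]]|[Xx Xy xy]]. Qed.

Lemma measurable_patch_dom t u g : measurable (patch_dom t u g).
Proof.
have -> : patch_dom t u g = X `&` overwrite t @^-1` X `&`
    [set x | overwrite u (overwrite t x) = x] `&`
    [set x | Psi x (overwrite t x) = g].
  by apply/seteqP; split=> x /= => [[]|[[[]]]].
apply: measurableI; last exact: measurable_Psi_overwrite.
apply: measurableI; last exact: measurable_overwriteK.
apply: measurableI => //; rewrite -[X in measurable X]setTI.
exact: measurable_overwrite.
Qed.

Lemma patch_dom_sub t u g : patch_dom t u g `<=` X.
Proof. by move=> x []. Qed.

Lemma patch_dom_overwrite t u g x :
  patch_dom t u g x -> patch_dom u t (- g) (overwrite t x).
Proof.
move=> [Xx Xtx tK Pg]; split=> //; rewrite tK// -Pg Psi_sym//.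
exact: tail_eq_overwrite.
Qed.

Lemma patch_tail t u g x : patch_dom t u g x -> tms_tail X x (overwrite t x).
Proof. by move=> [? ? ? ?]; apply/tms_tailE; split=> //; exact: tail_eq_overwrite. Qed.

(** One list turns [x] into [y] and another turns it back. *)
Lemma patch_cover x y : tms_tail X x y ->
  exists t u, overwrite t x = y /\ patch_dom t u (Psi x y) x.
Proof.
move=> /tms_tailE[Xx Xy xy]; have [t tE] := overwrite_tail_eq xy.
have [u uE] := overwrite_tail_eq (tail_eq_sym xy).
by exists t, u; split=> //; rewrite /patch_dom/= tE.
Qed.

(** Writing a direct image as a preimage under the inverse patch makes it measurable and, as a
    function of [A], a measure. *)
Lemma patch_imageE t u g (A : set Omega) : A `<=` patch_dom t u g ->
  overwrite t @` A = patch_dom u t (- g) `&` overwrite u @^-1` A.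
Proof.
move=> AD; apply/seteqP; split=> [_ [x Ax <-]|y [[_ _ yK _] Ay]]; last first.
  by exists (overwrite u y).
have Dx := AD _ Ax; split; first exact: patch_dom_overwrite.
by case: Dx => _ _ e _; rewrite /preimage/= e.
Qed.

Lemma patch_imageK t u g (A : set Omega) : A `<=` patch_dom t u g ->
  overwrite u @` (overwrite t @` A) = A.
Proof.
move=> AD; apply/seteqP; split=> [_ [_ [x Ax <-] <-]|x Ax].
  by have [_ _ -> _] := AD _ Ax.
by exists (overwrite t x); [exists x|have [] := AD _ Ax].
Qed.

Lemma patch_image_sub t u g (A : set Omega) : A `<=` patch_dom t u g ->
  overwrite t @` A `<=` patch_dom u t (- g).
Proof. by move=> AD _ [x /AD Dx <-]; exact: patch_dom_overwrite. Qed.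

Lemma measurable_patch_image t u g (A : set Omega) : measurable A ->
  A `<=` patch_dom t u g -> measurable (overwrite t @` A).
Proof.
move=> mA /patch_imageE ->; apply: measurableI; first exact: measurable_patch_dom.
by rewrite -[X in measurable X]setTI; exact: measurable_overwrite.
Qed.

Lemma patch_borel_bij t u g (A : set Omega) : measurable A ->
  A `<=` patch_dom t u g ->
  tms_borel_bij A (overwrite t @` A) (overwrite t).
Proof.
move=> mA AD; split=> //; split; first exact: measurable_patch_image AD.
split; first by move=> x Ax; exists x.
split.
  move=> x y /AD[_ _ xK _] /AD[_ _ yK _] e; by rewrite -xK e.
split; first by move=> _ [x Ax <-]; exists x.
split; first by apply: measurable_funTS; exact: measurable_overwrite.
move=> B mB BA; apply: (@measurable_patch_image t u g) => //.
exact: subset_trans AD.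
Qed.

(** A point of [X] is in the saturation exactly when some overwriting of it lies in [A], and lists
    are countable. *)
Lemma measurable_saturation_tail (A : set Omega) : measurable A -> A `<=` X ->
  measurable (tms_saturation (tms_tail X) A).
Proof.
move=> mA AX.
have -> : tms_saturation (tms_tail X) A = X `&` \bigcup_(t : seq S) (overwrite t @^-1` A).
  apply/seteqP; split=> [y [x [Ax /tms_tailE[Xx Xy xy]]]|y [Xy [t _ Aty]]].
    have [t tE] := overwrite_tail_eq (tail_eq_sym xy).
    by split=> //; exists t => //=; rewrite tE.
  exists (overwrite t y); split=> //; apply/tms_tailE; split=> //; first exact: AX.
  exact/tail_eq_sym/tail_eq_overwrite.
apply: measurableI => //; apply: countable_bigcupT_measurable => // t.
by rewrite -[X in measurable X]setTI; exact: measurable_overwrite.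
Qed.

Lemma saturation_tail_PsiE (A : set Omega) : A `<=` X ->
  tms_saturation (tms_tail_Psi X G) A =
  \bigcup_(k : seq S * seq S) (overwrite k.1 @` (A `&` patch_dom k.1 k.2 0)).
Proof.
move=> AX; apply/seteqP; split.
  move=> y [x [Ax [xy Pxy]]]; have [t [u [tE Dx]]] := patch_cover xy.
  by exists (t, u) => //; exists x => //=; split=> //; rewrite -Pxy.
move=> _ [[t u] _ [x [Ax Dx] <-]]; exists x; split=> //.
by split; [exact: patch_tail Dx|case: Dx].
Qed.

Lemma measurable_saturation_tail_Psi (A : set Omega) : measurable A -> A `<=` X ->
  measurable (tms_saturation (tms_tail_Psi X G) A).
Proof.
move=> mA AX; rewrite saturation_tail_PsiE//.
apply: countable_bigcupT_measurable => // -[t u] /=.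
apply: (@measurable_patch_image t u 0); last exact: subIsetr.
by apply: measurableI => //; exact: measurable_patch_dom.
Qed.

Lemma tail_Psi_trans x y z : tms_tail_Psi X G x y -> tms_tail_Psi X G y z ->
  tms_tail_Psi X G x z.
Proof.
move=> [/tms_tailE[Xx Xy xy] Pxy] [/tms_tailE[_ Xz yz] Pyz]; split.
  by apply/tms_tailE; split=> //; exact: tail_eq_trans yz.
by rewrite (Psi_trans G xy yz) Pxy Pyz addr0.
Qed.

End patches.

(** * Nonsingularity, invariance and ergodicity applied to patches *)

Section conformality.
Context (d : nat) (S : finType) (s0 : S).
Local Notation Omega := (cfgB d s0).
Implicit Types (x y z : Omega) (t u v w : seq S).
Context (X : set Omega) (mX : measurable X) (GG : countZmodType) (G : S -> GG).
Context (R : realType) (p : probability Omega R).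
Local Notation Psi := (@tms_Psi d S s0 GG G).
Local Notation patch_dom := (@patch_dom d S s0 X GG G).
Hypothesis nsp : tms_nonsingular p X (tms_tail X).
Hypothesis invp : tms_invariant p X (tms_tail_Psi X G).
Hypothesis ergp : tms_ergodic p X (tms_tail_Psi X G).

(** The image lies in the tail saturation of [A], which nonsingularity makes null. *)
Lemma patch_image_null t u g (A : set Omega) : measurable A ->
  A `<=` patch_dom t u g -> p A = 0%E -> p (overwrite t @` A) = 0%E.
Proof.
move=> mA AD pA; have AX : A `<=` X by move=> x /AD/patch_dom_sub.
have mtA := measurable_patch_image mX mA AD.
apply: (@subset_measure0 _ _ _ _ _ (tms_saturation (tms_tail X) A)) => //.
- exact: measurable_saturation_tail.
- by move=> _ [x Ax <-]; exists x; split=> //; exact: patch_tail (AD _ Ax).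
- exact: nsp.
Qed.

Lemma patch0_invariant t u (A : set Omega) : measurable A ->
  A `<=` patch_dom t u 0 -> p (overwrite t @` A) = p A.
Proof.
move=> mA AD; apply: (invp.2 _ _ _ (patch_borel_bij mX mA AD)) => //.
- by move=> x /AD/patch_dom_sub.
- by move=> _ [x /AD[_ ? _ _] <-].
- by move=> x /AD Dx; split; [exact: patch_tail Dx|case: Dx].
Qed.

(** By ergodicity the saturation of [A] under the kernel of [Psi] has full measure, so it meets [A']
    in positive measure. It is a countable union of images under patches of value 0, hence one of
    these images already does so. *)
Lemma ergodic_patch (A A' : set Omega) : measurable A -> measurable A' ->
  A `<=` X -> A' `<=` X -> (0 < p A)%E -> (0 < p A')%E ->
  exists t u B, [/\ measurable B, B `<=` A `&` patch_dom t u 0,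
    overwrite t @` B `<=` A' & (0 < p B)%E].
Proof.
move=> mA mA' AX A'X pA pA'.
pose Y := tms_saturation (tms_tail_Psi X G) A.
have mY : measurable Y by exact: measurable_saturation_tail_Psi.
have YX : Y `<=` X by move=> y [x [_ [/tms_tailE[]]]].
have AY : A `<=` Y.
  move=> x Ax; exists x; split=> //; split; last by rewrite Psi_refl.
  by apply/tms_tailE; split; [exact: AX|exact: AX|exact: tail_eq_refl].
have pY : p Y = 1%E.
  have Yinv x y : Y x -> tms_tail_Psi X G x y -> Y y.
    by move=> [z [Az zx]] xy; exists z; split=> //; exact: tail_Psi_trans xy.
  have [Y0|//] := ergp mY YX Yinv.
  by move: pA; rewrite (subset_measure0 mA mY AY Y0) ltxx.
have pA'Y : (0 < p (A' `&` Y))%E.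
  rewrite -(_ : p A' = p (A' `&` Y))//.
  rewrite -[in LHS](setUIDK A' Y) measureU0//.
  - exact: measurableI.
  - exact: measurableD.
  - apply: (@subset_measure0 _ _ _ _ _ (~` Y)) => //.
    + exact: measurableD.
    + exact: measurableC.
    + by apply: etrans (probability_setC p mY) _; rewrite pY subee.
have mF (k : seq S * seq S) :
    measurable (overwrite k.1 @` (A `&` patch_dom k.1 k.2 0)).
  apply: (measurable_patch_image mX) (@subIsetr _ _ _).
  by apply: measurableI => //; exact: measurable_patch_dom.
have [] := @exists_measure_gt0 _ _ _ p (seq S * seq S)%type (A' `&` Y)
  (fun k => overwrite k.1 @` (A `&` patch_dom k.1 k.2 0)) _ mF _ pA'Y.
- exact: measurableI.
- by rewrite -saturation_tail_PsiE//; exact: subIsetr.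
move=> [t u] /= pF.
pose B := A `&` patch_dom t u 0 `&` overwrite t @^-1` A'.
have mB : measurable B.
  apply: measurableI; first by apply: measurableI => //; exact: measurable_patch_dom.
  by rewrite -[X in measurable X]setTI; exact: measurable_overwrite.
have BD : B `<=` patch_dom t u 0 by move=> x [[]].
exists t, u, B; split=> //; first by move=> x [].
  by move=> _ [x [_ Ax] <-].
(* Invariance carries positivity from the image inside [A'] back to [B]. *)
rewrite -(patch0_invariant mB BD); apply: lt_le_trans pF _.
apply: le_measure; rewrite ?inE.
- by apply: measurableI; [exact: measurableI|exact: (mF (t, u))].
- exact: measurable_patch_image BD.
- move=> y [[A'y _] [x [Ax Dx] xy]]; exists x => //; split=> //.
  by rewrite /preimage/= xy.
Qed.

(** Going back along the patch and then along [Phi] has total value [- g + g = 0], so this composite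
    lies in the kernel and preserves [p]. *)
Lemma Psi_const_image (B C : set Omega) (Phi : Omega -> Omega) t u g :
  tms_borel_bij B C Phi -> (forall x, B x -> tms_tail X x (Phi x)) ->
  (forall x, B x -> Psi x (Phi x) = g) -> B `<=` patch_dom t u g ->
  p (Phi @` B) = p (overwrite t @` B).
Proof.
move=> bPhi tPhi PPhi BD; have mB : measurable B by case: bPhi.
have mtB := measurable_patch_image mX mB BD.
have tBD := patch_image_sub BD.
have bu := patch_borel_bij mX mtB tBD; rewrite (patch_imageK BD) in bu.
have := invp.2 _ _ _ (borel_bij_comp bu bPhi).
rewrite -[in LHS](patch_imageK BD) image_comp; apply=> //.
- by move=> y /tBD/patch_dom_sub.
- case: bPhi => _ [_ [_ [_ [Phis _]]]] z /Phis[x [Bx <-]].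
  by have /tms_tailE[] := tPhi x Bx.
- move=> _ [x Bx <-] /=; have [Xx Xtx tK Pg] := BD _ Bx; rewrite tK.
  have /tms_tailE[_ XPx xPx] := tPhi _ Bx.
  have txx : tail_eq (overwrite t x) x by exact/tail_eq_sym/tail_eq_overwrite.
  split; first by apply/tms_tailE; split=> //; exact: tail_eq_trans xPx.
  by rewrite (Psi_trans G txx xPx) PPhi// Psi_sym ?Pg ?addNr//; exact: tail_eq_overwrite.
Qed.

(* [A |-> p (overwrite t @` A)] on [patch_dom t u g], see [patch_measureE]. *)
Definition patch_measure t u g (A : set Omega) : \bar R :=
  p (patch_dom u t (- g) `&` overwrite u @^-1` A).

Lemma measurable_patch_preimage t u g (A : set Omega) : measurable A ->
  measurable (patch_dom u t (- g) `&` overwrite u @^-1` A).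
Proof.
move=> mA; apply: measurableI; first exact: measurable_patch_dom.
by rewrite -[X in measurable X]setTI; exact: measurable_overwrite.
Qed.

Section patch_measure_is_measure.
Context (t u : seq S) (g : GG).
Local Notation nu := (patch_measure t u g).

Let nu0 : nu set0 = 0%E.
Proof. by rewrite /patch_measure preimage_set0 setI0 measure0. Qed.

Let nu_ge0 A : (0 <= nu A)%E.
Proof. exact: measure_ge0. Qed.

Let nu_sigma_additive : semi_sigma_additive nu.
Proof.
move=> F mF tF mUF; rewrite /patch_measure preimage_bigcup setI_bigcupr.
apply: measure_semi_sigma_additive.
- by move=> n; exact: measurable_patch_preimage.
- apply/trivIsetP => /= i j _ _ ij; rewrite setIACA -preimage_setI.
  by move/trivIsetP : tF => /(_ _ _ _ _ ij) ->//; rewrite preimage_set0 setI0.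
- by rewrite -setI_bigcupr -preimage_bigcup; exact: measurable_patch_preimage.
Qed.

HB.instance Definition _ := isMeasure.Build _ _ _ nu nu0 nu_ge0 nu_sigma_additive.

Let nu_fin : fin_num_fun nu.
Proof. by move=> A mA; apply: fin_num_measure; exact: measurable_patch_preimage. Qed.

HB.instance Definition _ := Measure_isFinite.Build _ _ _ nu nu_fin.

End patch_measure_is_measure.

Lemma patch_measureE t u g (A : set Omega) : A `<=` patch_dom t u g ->
  patch_measure t u g A = p (overwrite t @` A).
Proof. by move=> AD; rewrite (patch_imageE AD). Qed.

Lemma patch_measure_dominates t u g : patch_measure t u g `<< p.
Proof.
move=> N N0 A mA AN; have pA := N0 _ mA AN.
have mAD : measurable (A `&` patch_dom t u g).
  by apply: measurableI => //; exact: measurable_patch_dom.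
(* The measure only sees [A] inside [patch_dom t u g], because the inverse patch takes values
   there. *)
rewrite (_ : patch_measure _ _ _ _ = patch_measure t u g (A `&` patch_dom t u g)).
  rewrite patch_measureE; last exact: subIsetr.
  apply: patch_image_null (@subIsetr _ _ _) _ => //.
  exact: subset_measure0 mAD mA (@subIsetl _ _ _) pA.
congr (p _); apply/seteqP; split=> y [Dy Ay]; split=> //; last by case: Ay.
by split=> //; have := patch_dom_overwrite Dy; rewrite opprK.
Qed.

(** A kernel patch [v] moves some [C] of positive measure from a light part of [A] into a heavy part
    of [A']. On [C], applying [t] and applying [v] then [t'] both have value [g], so the images have
    equal measure, at most [q] and at least [q'] times that of [C]. *)
Lemma patch_ratio_incomparable t u t' u' g (A A' : set Omega) (q q' : R) :
  measurable A -> measurable A' ->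
  A `<=` patch_dom t u g -> A' `<=` patch_dom t' u' g -> 0 <= q -> q < q' ->
  (p (overwrite t @` A) < q%:E * p A)%E ->
  (q'%:E * p A' < p (overwrite t' @` A'))%E -> False.
Proof.
move=> mA mA' AD A'D q0 qq'.
rewrite -(patch_measureE AD) -(patch_measureE A'D) => ltA ltA'.
have [B [mB BA pB Bq]] :=
  exists_light_subset (@patch_measure_dominates t u g) mA q0 ltA.
have [B' [mB' BA' pB' Bq']] := exists_heavy_subset
  (@patch_measure_dominates t' u' g) mA' (le_trans q0 (ltW qq')) ltA'.
have BX : B `<=` X by move=> x /BA/AD/patch_dom_sub.
have B'X : B' `<=` X by move=> x /BA'/A'D/patch_dom_sub.
have [v [w [C [mC CBD vCB' pC]]]] := ergodic_patch mB mB' BX B'X pB pB'.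
have CB : C `<=` B by move=> x /CBD[].
have CD : C `<=` patch_dom t u g by move=> x /CB/BA/AD.
have CDv : C `<=` patch_dom v w 0 by move=> x /CBD[].
have vCD : overwrite v @` C `<=` patch_dom t' u' g by move=> y /vCB'/BA'/A'D.
have mvC := measurable_patch_image mX mC CDv.
have leq : (p (overwrite t @` C) <= q%:E * p C)%E.
  by rewrite -(patch_measureE CD); exact: Bq.
have geq' : (q'%:E * p C <= p (overwrite t' @` (overwrite v @` C)))%E.
  by rewrite -(patch_measureE vCD) -(patch0_invariant mC CDv); exact: Bq'.
have bij := borel_bij_comp (patch_borel_bij mX mC CDv) (patch_borel_bij mX mvC vCD).
move: leq; rewrite -(Psi_const_image bij _ _ CD); last 2 first.
- move=> x Cx; have /tms_tailE[Xx _ _] := patch_tail (CD _ Cx).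
  have /tms_tailE[_ Xv xv] := patch_tail (CDv _ Cx).
  have vCx : (overwrite v @` C) (overwrite v x) by exists x.
  have /tms_tailE[_ Xtv vt] := patch_tail (vCD _ vCx).
  by apply/tms_tailE; split=> //; exact: tail_eq_trans vt.
- move=> x Cx; have [_ _ _ P0] := CDv _ Cx.
  have vCx : (overwrite v @` C) (overwrite v x) by exists x.
  have [_ _ _ Pg] := vCD _ vCx.
  rewrite (Psi_trans G (tail_eq_overwrite v x)); last exact: tail_eq_overwrite.
  by rewrite P0 Pg add0r.
rewrite -image_comp => /(le_trans geq').
by rewrite lee_pmul2r// ?fin_num_measure// lee_fin leNgt qq'.
Qed.

Lemma patch_image_gt0 t u g (A : set Omega) : measurable A ->
  A `<=` patch_dom t u g -> (0 < p A)%E -> (0 < p (overwrite t @` A))%E.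
Proof.
move=> mA AD pA; rewrite lt0e measure_ge0 andbT; apply/eqP => ptA.
have := patch_image_null (measurable_patch_image mX mA AD) (patch_image_sub AD) ptA.
by rewrite (patch_imageK AD) => pA0; rewrite pA0 ltxx in pA.
Qed.

(** The constant is the ratio on one reference patch of positive measure; any set of positive
    measure with another ratio would contradict [patch_ratio_incomparable]. *)
Lemma patch_image_proportional g : exists2 c : R, 0 < c &
  forall t u (A : set Omega), measurable A -> A `<=` patch_dom t u g ->
    p (overwrite t @` A) = (c%:E * p A)%E.
Proof.
have [[t0 [u0 pD]]|nD] := pselect (exists t u, (0 < p (patch_dom t u g))%E).
  pose D := patch_dom t0 u0 g; pose b := fine (p D).
  pose a := fine (p (overwrite t0 @` D)).
  have mD : measurable D by exact: measurable_patch_dom.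
  have mtD := measurable_patch_image mX mD (@subset_refl _ D).
  have bE : p D = b%:E by rewrite fineK// fin_num_measure.
  have aE : p (overwrite t0 @` D) = a%:E by rewrite fineK// fin_num_measure.
  have b0 : 0 < b by rewrite -lte_fin -bE.
  have a0 : 0 < a by rewrite -lte_fin -aE; exact: (patch_image_gt0 mD (@subset_refl _ D) pD).
  exists (a / b)%R; first exact: divr_gt0.
  move=> t u A mA AD; have [pA0|pA] := eqVneq (p A) 0%E.
    by rewrite pA0 mule0; exact: (patch_image_null mA AD pA0).
  have mtA := measurable_patch_image mX mA AD.
  pose b' := fine (p A); pose a' := fine (p (overwrite t @` A)).
  have b'E : p A = b'%:E by rewrite fineK// fin_num_measure.
  have a'E : p (overwrite t @` A) = a'%:E by rewrite fineK// fin_num_measure.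
  have b'0 : 0 < b' by rewrite -lte_fin -b'E lt0e pA measure_ge0.
  have a'0 : 0 <= a' by rewrite -lee_fin -a'E.
  have e : a' / b' = a / b.
    apply/eqP; rewrite eq_le !leNgt; apply/andP; split; apply/negP => h.
    (* Two successive midpoints supply thresholds [q < q'] strictly between the two ratios. *)
    + have h1 := midf_lt h; have h2 := midf_lt h1.2.
      apply: (@patch_ratio_incomparable t0 u0 t u g D A
        (((a / b) + (a' / b')) / 2) ((((a / b) + (a' / b')) / 2 + a' / b') / 2)) => //.
      * by rewrite (le_trans _ (ltW h1.1))// divr_ge0// ltW.
      * exact: h2.1.
      * by rewrite aE bE -EFinM lte_fin -ltr_pdivrMr// h1.1.
      * by rewrite a'E b'E -EFinM lte_fin -ltr_pdivlMr// h2.2.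
    + have h1 := midf_lt h; have h2 := midf_lt h1.2.
      apply: (@patch_ratio_incomparable t u t0 u0 g A D
        (((a' / b') + (a / b)) / 2) ((((a' / b') + (a / b)) / 2 + a / b) / 2)) => //.
      * by rewrite (le_trans _ (ltW h1.1))// divr_ge0// ltW.
      * exact: h2.1.
      * by rewrite a'E b'E -EFinM lte_fin -ltr_pdivrMr// h1.1.
      * by rewrite aE bE -EFinM lte_fin -ltr_pdivlMr// h2.2.
  by rewrite a'E b'E -EFinM -e divfK// gt_eqF.
(* All patches of value [g] are null, so both sides vanish and any positive constant serves. *)
exists 1%R => // t u A mA AD.
have pA : p A = 0%E.
  apply: (subset_measure0 mA (measurable_patch_dom mX G t u g) AD).
  apply/eqP/negPn/negP => pD0; apply: nD; exists t, u.
  by rewrite lt0e pD0 measure_ge0.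
by rewrite pA mule0; exact: (patch_image_null mA AD pA).
Qed.

(** * The density constants as a homomorphism *)

Section density_homomorphism.
Context (c : GG -> R).
Hypothesis c_gt0 : forall g, 0 < c g.
Hypothesis cP : forall g t u (A : set Omega), measurable A ->
  A `<=` patch_dom t u g -> p (overwrite t @` A) = ((c g)%:E * p A)%E.
Hypothesis pX : p X = 1%E.

(** These are the values at which [cP] determines [c]; elsewhere it only compares zeros. *)
Let charged g := exists t u, (0 < p (patch_dom t u g))%E.

(** The inverse patch lives on a set containing the image, which keeps positive measure. *)
Lemma charged_opp g : charged g -> charged (- g).
Proof.
move=> [t [u pD]]; exists u, t.
have mD := measurable_patch_dom mX G t u g.
apply: lt_le_trans (patch_image_gt0 mD (@subset_refl _ _) pD) _.
apply: le_measure; rewrite ?inE.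
- exact: measurable_patch_image (@subset_refl _ _).
- exact: measurable_patch_dom.
- exact: patch_image_sub.
Qed.

Lemma patch_dom_nil : patch_dom [::] [::] 0 = X.
Proof.
have nilE x : overwrite [::] x = x by apply/funext => n; rewrite /overwrite nth_nil.
apply/seteqP; split=> [x []//|x Xx]; split; rewrite ?nilE//.
exact: Psi_refl.
Qed.

Lemma charged0 : charged 0.
Proof. by exists [::], [::]; rewrite patch_dom_nil pX. Qed.

(** The empty list is the identity patch on [X]. *)
Lemma density0 : c 0 = 1.
Proof.
have := cP mX; move/(_ 0 [::] [::]); rewrite patch_dom_nil => /(_ (@subset_refl _ _)).
rewrite [X in p X](_ : _ = X) ?pX ?mule1; last first.
  apply/seteqP; split=> [_ [x Xx <-]|x Xx]; last exists x => //.
    by rewrite (_ : overwrite _ _ = x)//; apply/funext => n; rewrite /overwrite nth_nil.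
  by apply/funext => n; rewrite /overwrite nth_nil.
by case.
Qed.

(** A patch of value [g], a kernel patch and a patch of value [g'] compose on a set of positive
    measure. The composite has value [g + g'] and multiplies measure by [c g * c g']. *)
Lemma charged_add g g' : charged g -> charged g' ->
  charged (g + g') /\ c (g + g') = c g * c g'.
Proof.
move=> /charged_opp[u [t pD]] [t' [u' pD']].
(* Ergodicity links the range side of the first patch to the domain of the second. *)
have [v [w [C [mC CD vCD' pC]]]] := ergodic_patch (measurable_patch_dom mX G u t (- g))
  (measurable_patch_dom mX G t' u' g') (@patch_dom_sub _ _ _ _ _ _ _ _ _)
  (@patch_dom_sub _ _ _ _ _ _ _ _ _) pD pD'.
have CDu : C `<=` patch_dom u t (- g) by move=> x /CD[].
have CDv : C `<=` patch_dom v w 0 by move=> x /CD[].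
pose B := overwrite u @` C.
have mB : measurable B by exact: measurable_patch_image CDu.
have BD : B `<=` patch_dom t u g by rewrite -[g]opprK; exact: patch_image_sub.
have pB : (0 < p B)%E by exact: patch_image_gt0 CDu pC.
have tB : overwrite t @` B = C by exact: patch_imageK CDu.
pose Phi : Omega -> Omega := overwrite t' \o (overwrite v \o overwrite t).
have PhiP x : B x -> tms_tail X x (Phi x) /\ Psi x (Phi x) = g + g'.
  move=> Bx; have [Xx _ _ Pg] := BD _ Bx.
  have tx := tail_eq_overwrite t x.
  have Cx : C (overwrite t x) by rewrite -tB; exists x.
  have [_ _ _ P0] := CDv _ Cx.
  have vtx := tail_eq_overwrite v (overwrite t x).
  have [_ XPhi _ Pg'] : patch_dom t' u' g' (overwrite v (overwrite t x)).
    by apply: vCD'; exists (overwrite t x).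
  have tvtx := tail_eq_overwrite t' (overwrite v (overwrite t x)).
  split.
    apply/tms_tailE; split=> //.
    exact: tail_eq_trans tx (tail_eq_trans vtx tvtx).
  rewrite (Psi_trans G tx (tail_eq_trans vtx tvtx)) (Psi_trans G vtx tvtx).
  by rewrite Pg P0 Pg' add0r.
(* Some single patch of value [g + g'] covers a part of [B] of positive measure; on it the image
   measure is computed in two ways. *)
have [||[t2 u2] /= pB2] := @exists_measure_gt0 _ _ _ p (seq S * seq S)%type B
    (fun k => patch_dom k.1 k.2 (g + g')) mB _ _ pB.
- by move=> k; exact: measurable_patch_dom.
- move=> x Bx; have [tP PP] := PhiP x Bx; have [t2 [u2 [_ Dx]]] := patch_cover G tP.
  by exists (t2, u2) => //; rewrite -PP.
have mD2 := measurable_patch_dom mX G t2 u2 (g + g').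
pose B2 := B `&` patch_dom t2 u2 (g + g').
have mB2 : measurable B2 by exact: measurableI.
have B2B : B2 `<=` B by exact: subIsetl.
have B2D : B2 `<=` patch_dom t u g by move=> x /B2B/BD.
have B2D2 : B2 `<=` patch_dom t2 u2 (g + g') by exact: subIsetr.
split.
  exists t2, u2; apply: lt_le_trans pB2 _.
  by apply: le_measure; rewrite ?inE.
have mtB2 := measurable_patch_image mX mB2 B2D.
have tB2C : overwrite t @` B2 `<=` C by rewrite -tB; exact: image_subset.
have tB2D : overwrite t @` B2 `<=` patch_dom v w 0 by move=> x /tB2C/CDv.
have mvB2 := measurable_patch_image mX mtB2 tB2D.
have vB2D : overwrite v @` (overwrite t @` B2) `<=` patch_dom t' u' g'.
  by apply: subset_trans vCD'; exact: image_subset.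
have bij := borel_bij_comp (borel_bij_comp (patch_borel_bij mX mB2 B2D)
  (patch_borel_bij mX mtB2 tB2D)) (patch_borel_bij mX mvB2 vB2D).
have := Psi_const_image bij (fun x Bx => (PhiP x (B2B x Bx)).1)
  (fun x Bx => (PhiP x (B2B x Bx)).2) B2D2.
rewrite -!image_comp (cP mvB2 vB2D) (patch0_invariant mtB2 tB2D) (cP mB2 B2D).
rewrite (cP mB2 B2D2) muleA.
have pB2E : p B2 = (fine (p B2))%:E by rewrite fineK// fin_num_measure.
rewrite pB2E -!EFinM => -[e]; rewrite mulrC; apply/esym; apply: mulIf e.
by rewrite gt_eqF// -lte_fin -pB2E.
Qed.

Lemma density_homomorphism : exists H : GG -> R,
  (forall a b, H (a + b) = H a + H b) /\
  forall g, charged g -> expR (H g) = c g.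
Proof.
pose f := [set z : GG * R | charged z.1 /\ z.2 = ln (c z.1)].
have f0 : f (0, 0) by split; [exact: charged0|rewrite /= density0 ln1].
have fP : partial_hom f.
  split=> [a b v w [/= ca ->] [/= cb ->]|w [_ /= ->]]; last by rewrite density0 ln1.
  have cNb := charged_opp cb; have [cab e] := charged_add ca cNb.
  split=> //=; rewrite e lnM ?posrE//; congr (_ + _).
  (* Since [c b * c (- b) = c 0 = 1], the logarithm of [c] changes sign under negation. *)
  have [_] := charged_add cb cNb; rewrite subrr density0 => /esym e1.
  by apply/eqP; rewrite eq_sym -addr_eq0 addrC -lnM ?posrE// e1 ln1.
have [H [HD HP]] := partial_hom_extend fP f0.
by exists H; split=> // g cg; rewrite (HP g (ln (c g)))// lnK ?posrE.
Qed.

End density_homomorphism.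

(** * From patches to arbitrary Borel bijections *)

(** The set [A] splits into countably many pieces on each of which [Phi] agrees with one patch;
    there the integrand is constant and the claim is the hypothesis. *)
Lemma conformal_of_density (H : GG -> R) :
  (forall g t u (A : set Omega), measurable A -> A `<=` patch_dom t u g ->
    p (overwrite t @` A) = ((expR (H g))%:E * p A)%E) ->
  tms_conformal p X (fun x y => H (Psi x y)).
Proof.
move=> HP B C Phi bPhi BX CX tPhi A mA AB.
have [mB [mC [PhiBC [Phii [Phis [mPhi Phim]]]]]] := bPhi.
pose f x := (expR (H (Psi x (Phi x))))%:E : \bar R.
(* Countability of [GG] keeps this family of pieces countable. *)
pose F (k : seq S * seq S * GG) :=
  A `&` patch_dom k.1.1 k.1.2 k.2 `&` [set x | Phi x = overwrite k.1.1 x].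
have mF k : measurable (F k).
  have mAD : measurable (A `&` patch_dom k.1.1 k.1.2 k.2).
    by apply: measurableI => //; exact: measurable_patch_dom.
  apply: measurable_eq_fun => //; last first.
    by apply: measurable_funTS; exact: measurable_overwrite.
  by apply: measurable_funS mPhi => // x [/AB].
have AF : A = \bigcup_k F k.
  apply/seteqP; split=> [x Ax|x [k _ [[]]]//].
  have [t [u [tE Dx]]] := patch_cover G (tPhi _ (AB _ Ax)).
  by exists (t, u, Psi x (Phi x)).
have fF k x : F k x -> f x = (expR (H k.2))%:E.
  by move=> [[_ [_ _ _ <-]] /= e]; rewrite /f e.
have FE k E : measurable E -> E `<=` F k ->
    p (Phi @` E) = (\int[p]_(x in E) f x)%E.
  move=> mE EF; rewrite (eq_integral (cst (expR (H k.2))%:E)); last first.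
    by move=> x; rewrite inE => /EF/fF ->.
  have ED : E `<=` patch_dom k.1.1 k.1.2 k.2 by move=> x /EF[[]].
  rewrite integral_cst// -(HP _ _ _ _ mE ED); congr (p _).
  by apply: eq_imagel => x /EF[].
pose F' n := if @unpickle _ n is Some k then F k else set0.
have mF' n : measurable (F' n) by rewrite /F'; case: unpickle.
(* The pieces overlap, so they are made disjoint before summing. *)
pose E := seqDU F'.
have mE n : measurable (E n).
  by apply: measurableD => //; exact: bigsetU_measurable.
have AE : A = \bigcup_n E n.
  by rewrite AF bigcup_unpickle -seqDU_bigcup_eq.
have tE : trivIset setT E by exact: trivIset_seqDU.
have EB n : E n `<=` B by move=> x Ex; apply: AB; rewrite AE; exists n.
have EP n : p (Phi @` E n) = (\int[p]_(x in E n) f x)%E.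
  have : E n `<=` F' n by exact: subset_seqDU.
  rewrite /F'; case: unpickle => [k|] EF; first exact: FE EF.
  have -> : E n = set0 by exact/seteqP.
  by rewrite image_set0 measure0 integral_set0.
have mf : measurable_fun A f.
  rewrite AF bigcup_unpickle; apply/measurable_fun_bigcup => // n.
  case: unpickle => [k|]; last exact: measurable_fun_set0.
  by apply: (eq_measurable_fun (cst (expR (H k.2))%:E)) => // x; rewrite inE => /fF.
have -> : (\int[p]_(x in A) f x = \sum_(n <oo) \int[p]_(x in E n) f x)%E.
  rewrite AE; apply: ge0_integral_bigcup => //; first by rewrite -AE.
  by move=> x _; rewrite lee_fin expR_ge0.
rewrite AE image_bigcup measure_semi_bigcup.
- by apply: eq_eseriesr => n _; exact: EP.
- by move=> n; apply: Phim => //; exact: EB.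
(* Injectivity of [Phi] keeps the images disjoint. *)
- apply/trivIsetP => i j _ _ ij; apply/seteqP; split=> // _ [[x Ex <-] [y Ey]].
  move=> /(Phii _ _ (EB _ _ Ey) (EB _ _ Ex)) e; rewrite e in Ey.
  have e0 : E i `&` E j = set0 by move/trivIsetP : tE; exact.
  by have : (E i `&` E j) x by []; rewrite e0.
- by rewrite -image_bigcup -AE; exact: Phim.
Qed.

End conformality.

(** * Assembling the homomorphism and the conformality of [p] *)

Theorem theorem1 (S : finType) (s0 : S) (d : nat) (X : set (cfgB d s0))
  (GG : countZmodType) (G : S -> GG) (R : realType)
  (p : probability (cfgB d s0) R) :
  (0 < d)%N ->
  tms_is_TMS X -> tms_irreducible X -> tms_top_transitive X (tms_tail X) ->
  p X = 1%E ->
  tms_global p X ->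
  tms_nonsingular p X (tms_tail X) ->
  tms_invariant p X (tms_tail_Psi X G) ->
  tms_ergodic p X (tms_tail_Psi X G) ->
  exists H : GG -> R,
    (forall a b : GG, H (a + b) = H a + H b) /\
    tms_conformal p X (fun x y => H (tms_Psi G x y)).
Proof.
move=> _ /measurable_TMS mX _ _ pX _ nsp invp ergp.
have c_ex g : exists c : R, 0 < c /\ forall t u (A : set (cfgB d s0)),
    measurable A -> A `<=` patch_dom X G t u g ->
    p (overwrite t @` A) = (c%:E * p A)%E.
  by have [c] := patch_image_proportional mX nsp invp ergp g; exists c.
have [c /all_and2[c0 cP]] := choice c_ex.
have [H [HD HE]] := density_homomorphism mX nsp invp ergp c0 cP pX.
exists H; split=> //; apply: conformal_of_density => // g t u A mA AD.
(* On a null patch [expR (H g)] may differ from [c g], but [A] and its image are both null. *)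
have [pD|pD] := eqVneq (p (patch_dom X G t u g)) 0%E.
  have pA := subset_measure0 mA (measurable_patch_dom mX G t u g) AD pD.
  by rewrite (cP g t u)// pA !mule0.
by rewrite (HE g) ?(cP g t u)//; exists t, u; rewrite lt0e pD measure_ge0.
Qed.
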